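(* Let $n \geq 1$, let $\mathbf{X} = \mathbb{R}^n$, and let $\alpha \in (0,1)$. Then there exists a polynomial $f \in \mathbb{R}[\mathbf{x}] = \mathbb{R}[x_1,\dots,x_n]$ that attains its minimum $f_{\min} = \min_{\mathbf{x} \in \mathbb{R}^n} f(\mathbf{x})$ on $\mathbb{R}^n$, but for which \[ \lim_{r \to \infty} \mathrm{ub}(f,\Gamma_\alpha)_r > f_{\min}. \] In fact, for $n = 1$ one may take $f(x) = x^2$.
   Context: For $\alpha > 0$, $\Gamma_\alpha$ denotes the probability measure on $\mathbb{R}^n$ with density $w_\alpha(\mathbf{x}) = C_\alpha \exp\left(-\sum_{i=1}^n |x_i|^\alpha\right)$ with respect to the Lebesgue measure on $\mathbb{R}^n$, where $C_\alpha > 0$ is the normalizing constant. All its moments are finite. For $r \in \mathbb{N}$, $\Sigma[\mathbf{x}]_{2r}$ denotes the cone of sums of squares $p_1^2 + \dots + p_\ell^2$ of polynomials $p_i \in \mathbb{R}[x_1,\dots,x_n]$ of degree at most $r$. For a polynomial $f \in \mathbb{R}[\mathbf{x}]$, a finite Borel measure $\mu$ on $\mathbb{R}^n$ with finite moments, and $r \in \mathbb{N}$, define \[ \mathrm{ub}(f,\mu)_r := \min_{\sigma \in \Sigma[\mathbf{x}]_{2r}} \left\{ \int_{\mathbb{R}^n} f(\mathbf{x})\sigma(\mathbf{x})\, d\mu(\mathbf{x}) : \int_{\mathbb{R}^n} \sigma(\mathbf{x})\, d\mu(\mathbf{x}) = 1 \right\}. \] This sequence is non-increasing in $r$ and, when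 $f$ attains its minimum $f_{\min}$ on $\mathbb{R}^n$ and $\mu$ is supported on $\mathbb{R}^n$, satisfies $\mathrm{ub}(f,\mu)_r \geq f_{\min}$. *)

(* Defs.v *)
From HB Require Import structures.
From mathcomp Require Import all_boot all_order all_algebra.
(* The notations of mpoly clash with those of MathComp-Analysis. *)
From mathcomp Require Import -(notations) mpoly.
From mathcomp Require Import all_classical all_reals all_analysis.
From mathcomp Require Import measurable_realfun.

Set Implicit Arguments.
Unset Strict Implicit.
Unset Printing Implicit Defensive.

Import Order.TTheory GRing.Theory Num.Theory.
Import numFieldNormedType.Exports.

Local Open Scope classical_set_scope.
Local Open Scope ring_scope.

Section minimum.
Context {R : realType}.
Implicit Types (S : set R) (m : R).

Definition is_minimum S m := S m /\ lbound S m.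

Definition has_minimum S := exists m, is_minimum S m.

(* Minimum in the strict sense (attained), not an infimum; the value is 0 when
   S has no least element. *)
Definition minimum S : R := xget 0 [set m | is_minimum S m].

Lemma minimumE S m : is_minimum S m -> minimum S = m.
Proof.
move=> Sm; rewrite /minimum; case: xgetP => [x -> [Sx xlb]|/(_ m)//].
by case: Sm => Sm mlb; apply/eqP; rewrite eq_le xlb// mlb.
Qed.

End minimum.

Section lebesgue_tcons.
Context {R : realType} (n : nat).
Variable mu : {sigma_finite_measure set (n.-tuple R) -> \bar R}.
Local Open Scope ereal_scope.

Definition tcons (x : R * n.-tuple R) : n.+1.-tuple R := [tuple of x.1 :: x.2].

Lemma measurable_tcons : measurable_fun [set: R * n.-tuple R] tcons.
Proof. exact: measurable_cons. Qed.

Definition lebesgue_tcons : set (n.+1.-tuple R) -> \bar R :=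
  pushforward (@lebesgue_measure R \x mu) tcons.

Let mf := measurable_tcons.

Let lebesgue_tcons0 : lebesgue_tcons set0 = 0.
Proof. by rewrite /lebesgue_tcons /pushforward preimage_set0 measure0. Qed.

Let lebesgue_tcons_ge0 A : 0 <= lebesgue_tcons A.
Proof. exact: measure_ge0. Qed.

Let lebesgue_tcons_sigma_additive : semi_sigma_additive lebesgue_tcons.
Proof.
pose m := isMeasurableFun.Build _ _ _ _ _ mf.
pose f : {mfun _ >-> _} := HB.pack tcons m.
exact: (@measure_semi_sigma_additive _ _ _
  (pushforward (@lebesgue_measure R \x mu) f)).
Qed.

HB.instance Definition _ := isMeasure.Build _ _ _ lebesgue_tcons
  lebesgue_tcons0 lebesgue_tcons_ge0 lebesgue_tcons_sigma_additive.

Let lebesgue_tcons_sigma_finite : sigma_finite setT lebesgue_tcons.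
Proof.
have /sigma_finiteP[F [FT ndF Foo]] := sigma_finiteT (@lebesgue_measure R).
have /sigma_finiteP[G [GT ndG Goo]] := sigma_finiteT mu.
pose un (t : n.+1.-tuple R) := (thead t, [tuple of behead t]).
have mun : measurable_fun setT un.
  by apply/measurable_fun_pairP; split;
    [exact: measurable_tnth|exact: measurable_behead].
have unK : cancel tcons un by case=> x t; congr pair; apply/val_inj.
exists (fun i => un @^-1` (F i `*` G i)).
  apply/seteqP; split=> // t _.
  have [i _ Fi] : (\bigcup_i F i) (un t).1 by rewrite -FT.
  have [j _ Gj] : (\bigcup_i G i) (un t).2 by rewrite -GT.
  exists (maxn i j) => //; split.
    by move: Fi; exact/subsetPset/ndF/leq_maxl.
  by move: Gj; exact/subsetPset/ndG/leq_maxr.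
move=> i; have [mFi Fioo] := Foo i; have [mGi Gioo] := Goo i; split.
  by rewrite -[X in measurable X]setTI; apply: mun => //; exact: measurableX.
rewrite /lebesgue_tcons /pushforward -comp_preimage.
rewrite (_ : un \o tcons = id); last by apply/funext => x; exact: unK.
by rewrite preimage_id product_measure1E// lte_mul_pinfty// ge0_fin_numE.
Qed.

HB.instance Definition _ := Measure_isSigmaFinite.Build _ _ _ lebesgue_tcons
  lebesgue_tcons_sigma_finite.

End lebesgue_tcons.

Section lebesgue_tuple.
Context {R : realType}.
Local Open Scope ereal_scope.

(* Lebesgue measure on R^n, realized as n.-tuple R with its product
   sigma-algebra. *)
Fixpoint lebesgue_tuple n : {sigma_finite_measure set (n.-tuple R) -> \bar R} :=
  match n with
  | 0%N => \d_([tuple] : 0.-tuple R)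
  | m.+1 => lebesgue_tcons (lebesgue_tuple m)
  end.

Lemma lebesgue_tuple_box n (A : 'I_n -> set R) :
  (forall i, measurable (A i)) ->
  lebesgue_tuple n [set x | forall i, A i (tnth x i)] =
  \prod_(i < n) lebesgue_measure (A i).
Proof.
elim: n A => [|n ih] A mA.
  by rewrite big_ord0 /= diracE mem_set//= => -[].
rewrite big_ord_recl -ih//= /lebesgue_tcons /pushforward -product_measure1E//.
- congr ((_ \x _) _); apply/seteqP; split=> -[x t] /=.
    move=> h; split; first exact: (h ord0).
    by move=> i; have := h (lift ord0 i); rewrite tnthS.
  move=> [h0 h] i; have [->|] := eqVneq i ord0; first exact: h0.
  by move=> i0; case: (unliftP ord0 i) i0 => [j ->|->//] _; rewrite tnthS.
- exact: mA.
- set B := (X in measurable X).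
  have -> : B = \bigcap_(i in [set: 'I_n])
      ((fun x : n.-tuple R => tnth x i) @^-1` A (lift ord0 i)).
    by apply/seteqP; split=> [x /= h i _|x h i]; [exact: h|exact: (h i)].
  apply: fin_bigcap_measurable => // i _.
  by rewrite -[X in measurable X]setTI; exact: measurable_tnth.
Qed.

End lebesgue_tuple.

Section Gamma.
Context {R : realType} (alpha : R) (n : nat).

Definition Gamma_weight (x : n.-tuple R) : R :=
  expR (- \sum_(i < n) `|tnth x i| `^ alpha).

Definition Gamma_pdf (x : n.-tuple R) : R :=
  (\int[lebesgue_tuple n]_y Gamma_weight y)^-1 * Gamma_weight x.

Lemma measurable_Gamma_weight : measurable_fun setT Gamma_weight.
Proof.
apply: measurableT_comp => //; apply: measurableT_comp => //.
apply: measurable_sum => i.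
apply: (measurableT_comp (measurable_powR alpha)).
by apply: measurableT_comp => //; exact: measurable_tnth.
Qed.

Lemma Gamma_pdf_ge0 x : 0 <= Gamma_pdf x.
Proof.
rewrite mulr_ge0 ?expR_ge0// invr_ge0 Rintegral_ge0// => y _.
exact: expR_ge0.
Qed.

Lemma measurable_Gamma_pdf : measurable_fun setT Gamma_pdf.
Proof. exact: measurable_funM measurable_Gamma_weight. Qed.

Definition Gamma (A : set (n.-tuple R)) : \bar R :=
  (\int[lebesgue_tuple n]_(x in A) (Gamma_pdf x)%:E)%E.

Let Gamma0 : Gamma set0 = 0%E.
Proof. by rewrite /Gamma integral_set0. Qed.

Let Gamma_ge0 A : (0 <= Gamma A)%E.
Proof. by apply: integral_ge0 => x _; rewrite lee_fin Gamma_pdf_ge0. Qed.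

Let Gamma_sigma_additive : semi_sigma_additive Gamma.
Proof.
move=> F mF tF mUF; rewrite /Gamma ge0_integral_bigcup//=; last 2 first.
- apply/measurable_EFinP; apply: measurable_funTS; exact: measurable_Gamma_pdf.
- by move=> x _; rewrite lee_fin Gamma_pdf_ge0.
by apply: is_cvg_ereal_nneg_natsum_cond => k _ _; exact: Gamma_ge0.
Qed.

HB.instance Definition _ := isMeasure.Build _ _ _ Gamma
  Gamma0 Gamma_ge0 Gamma_sigma_additive.

End Gamma.
Arguments Gamma {R} alpha n A.

Section upper_bound.
Context {R : realType} {n : nat}.
Implicit Types (f p : mpoly n R) (mu : {measure set (n.-tuple R) -> \bar R}).

Definition peval p (x : n.-tuple R) : R := meval (tnth x) p.

(* The cone usually written Sigma[x]_{2r}: r bounds the degrees of the squared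
   polynomials. mmeasure mdeg p is msize p, i.e., one more than the total degree
   of p, and 0 for p = 0. *)
Definition sos (r : nat) : set (mpoly n R) :=
  [set s | exists2 ps : seq (mpoly n R),
    all (fun p => mmeasure mdeg p <= r.+1)%N ps & s = \sum_(p <- ps) p ^+ 2].

Definition ub f mu (r : nat) : R :=
  minimum [set \int[mu]_x (peval f x * peval s x) |
           s in [set s | sos r s /\ \int[mu]_x peval s x = 1]].

End upper_bound.

(* Main.v *)
From HB Require Import structures.
Require Import Defs.
From mathcomp Require Import all_boot all_order all_algebra.
From mathcomp Require Import -(notations) mpoly.
From mathcomp Require Import all_classical all_reals all_analysis.
From mathcomp Require Import measurable_realfun ring lra.
Set Implicit Arguments.
Unset Strict Implicit.
Unset Printing Implicit Defensive.
Import Order.TTheory GRing.Theory Num.Theory.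
Import numFieldNormedType.Exports.
Local Open Scope classical_set_scope.
Local Open Scope ring_scope.

(* For every n the polynomial f = x_0^2 works. Put
     h(y) = exp(-|y|^alpha) cos(t |y|^alpha),  t = tan(alpha pi / 2).
   Since alpha < 1, all the moments of h vanish: rotating the ray of integration
   in the Gamma integral of u^(s-1) e^(-u) gives
     int_0^oo y^(2k) e^(-(1 - i t) y^alpha) dy
       = Gamma(s) (1 - i t)^(-s) / alpha,  s = (2k+1) / alpha,
   and (1 - i t)^(-s) has argument s alpha pi / 2 = (2k+1) pi / 2, so its real
   part is 0 (the odd moments vanish by symmetry). Hence p^2 is orthogonal to
   cos(t |x_0|^alpha) in L^2(Gamma_alpha) for every polynomial p. As
   cos(t |y|^alpha) > 1/2 for |y| < d, we have
     d^2/3 <= d^2/3 * 2 cos(t |y|^alpha) + y^2  for all y,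
   and integrating against p^2 gives d^2/3 int p^2 <= int x_0^2 p^2. So all
   upper bounds are at least d^2/3, while the minimum of f is 0.
   The minimum defining ub is attained because it is the minimum of a Rayleigh
   quotient on a finite-dimensional space. *)

(** * Minima of Rayleigh quotients *)

Lemma continuous_sum {R : realType} {T : topologicalType} I (r : seq I)
    (F : I -> T -> R) :
  (forall i, continuous (F i)) -> continuous (fun x => \sum_(i <- r) F i x).
Proof. by move=> cF; apply: continuous_big => // x; exact: add_continuous. Qed.

Section positive_functional.
Context {R : realType} {A : comAlgType R} (L : {scalar A}).
Hypothesis L_sqr_ge0 : forall a, 0 <= L (a ^+ 2).

(** The degenerate case of Cauchy-Schwarz: when [L (a ^+ 2) = 0], [L ((t *: a + b) ^+ 2)] is affine
    in [t], so a nonzero slope would make it negative somewhere; the chosen [t] gives the value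
    -1. *)
Lemma positive_functional_null a b : L (a ^+ 2) = 0 -> L (a * b) = 0.
Proof.
move=> La0; apply/eqP/negPn/negP => Lab.
pose t := - (L (b ^+ 2) + 1) / (2 * L (a * b)).
have := L_sqr_ge0 (t *: a + b).
rewrite sqrrD exprZn -scalerAl !(linearD, linearZ, linearMn)/= La0.
have -> : t * L (a * b) = - (L (b ^+ 2) + 1) / 2 by rewrite /t; field.
by rewrite leNgt => /negP; apply; lra.
Qed.

(* Stated as Parseval's identity, which tolerates vectors of norm 0. *)
Lemma gram_schmidt (S : A -> Prop) :
  (forall c u v, S u -> S v -> S (c *: u + v)) ->
  forall s : seq A, (forall x, x \in s -> S x) ->
  exists n (e : 'I_n -> A), [/\ (forall i, S (e i)),
    (forall i j, L (e i * e j) = (i == j)%:R) &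
    forall x, x \in s -> forall w,
      L (x * w) = \sum_i L (x * e i) * L (e i * w)].
Proof.
move=> Slin; elim=> [_|x s ih Sxs]; first by exists 0%N, (fun=> 0);
  split=> // -[].
have [n [e [Se eo es]]] := ih (fun y ys => Sxs y (mem_behead (s := x :: s) ys)).
have Sx : S x by apply: Sxs; rewrite mem_head.
pose u := x - \sum_i L (x * e i) *: e i.
have Su : S u.
  rewrite /u -sumrN.
  have : forall r : seq 'I_n, S (x + \sum_(i <- r) - (L (x * e i) *: e i)).
    elim=> [|i r Sr]; first by rewrite big_nil addr0.
    by rewrite big_cons -scaleNr addrCA; exact: Slin.
  exact.
have Luw w : L (x * w) = L (u * w) + \sum_i L (x * e i) * L (e i * w).
  rewrite mulrBl raddfB/= mulr_suml raddf_sum/=.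
  rewrite [X in _ - X](eq_bigr (fun i => L (x * e i) * L (e i * w))) ?subrK//.
  by move=> i _; rewrite -scalerAl linearZ.
have Lue i : L (u * e i) = 0.
  have := Luw (e i); rewrite (bigD1 i)//= eo eqxx mulr1 big1 => [|j ji].
    by move/eqP; rewrite addr0 -subr_eq subrr => /eqP.
  by rewrite eo (negbTE ji) mulr0.
(* A residue [u] of norm 0 pairs to 0 with everything, so the old family already satisfies Parseval
   for [x]; otherwise [u] is normalized and added. *)
have [u0|u0] := eqVneq (L (u ^+ 2)) 0.
  exists n, e; split=> // y; rewrite inE => /predU1P[->|/es//] w.
  by rewrite Luw positive_functional_null ?add0r.
set d := L (u ^+ 2) in u0.
have d0 : 0 < d by rewrite lt0r u0 L_sqr_ge0.
pose q := (Num.sqrt d)^-1.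
have qq : q * q * d = 1.
  by rewrite /q -expr2 exprVn sqr_sqrtr ?ltW// mulVf.
pose e' (i : 'I_n.+1) := if unlift ord0 i is Some j then e j else q *: u.
have e'0 : e' ord0 = q *: u by rewrite /e' unlift_none.
have e'S i : e' (lift ord0 i) = e i by rewrite /e' liftK.
exists n.+1, e'; split.
- move=> i; case: (unliftP ord0 i) => [j ->|->]; rewrite ?e'S ?e'0//.
  have := Slin (q - 1) u u Su Su.
  by rewrite -{2}[u]scale1r -scalerDl subrK.
- move=> i j; case: (unliftP ord0 i) => [i' ->|->];
    case: (unliftP ord0 j) => [j' ->|->].
  + by rewrite !e'S eo (inj_eq lift_inj).
  + by rewrite e'S e'0 mulrC -scalerAl linearZ/= Lue mulr0.
  + by rewrite e'S e'0 -scalerAl linearZ/= Lue mulr0.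
  + rewrite e'0 -scalerAl -scalerAr !linearZ/= mulrA -(expr2 u).
    by rewrite -/d qq ?eqxx.
- move=> y; rewrite inE => yxs w; rewrite big_ord_recl e'0.
  under eq_bigr do rewrite e'S.
  rewrite -scalerAr -scalerAl !linearZ/=.
  case/predU1P: yxs => [->|ys].
    rewrite Luw; congr +%R.
    rewrite (Luw u) -expr2 -/d big1 ?addr0; last first.
      by move=> i _; rewrite (mulrC (e i)) Lue mulr0.
    by rewrite mulrACA mulrA qq mul1r.
  rewrite (es _ ys u) big1 ?mulr0 ?mul0r ?add0r; first exact: es.
  by move=> i _; rewrite (mulrC (e i)) Lue mulr0.
Qed.

(** Up to vectors of norm 0, an orthonormal family identifies the space with a Euclidean one; there
    the form [L (f * v ^+ 2)] is a polynomial in the coordinates and attains its minimum on the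
    compact unit sphere. Homogeneity extends the inequality to all [v]. *)
Lemma min_rayleigh_quotient (f : A) (S : A -> Prop) (I : finType) (g : I -> A)
    v0 :
  (forall c u v, S u -> S v -> S (c *: u + v)) ->
  (forall i, S (g i)) ->
  (forall v, S v -> exists c : I -> R, v = \sum_i c i *: g i) ->
  S v0 -> 0 < L (v0 ^+ 2) ->
  exists m, [/\ S m, L (m ^+ 2) = 1 &
    forall v, S v -> L (f * m ^+ 2) * L (v ^+ 2) <= L (f * v ^+ 2)].
Proof.
move=> Slin Sg spanS Sv0 v0_gt0.
have Scodom x : x \in codom g -> S x by move=> /codomP[i ->].
have [n [e [Se eo es]]] := gram_schmidt Slin Scodom.
have parseval v : S v -> forall w, L (v * w) = \sum_i L (v * e i) * L (e i * w).
  move=> /spanS[c ->] w; rewrite mulr_suml raddf_sum/=.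
  under [RHS]eq_bigr do rewrite mulr_suml raddf_sum/= mulr_suml.
  rewrite exchange_big/=; apply: eq_bigr => k _.
  rewrite -scalerAl linearZ/= (es _ (codom_f g k)) mulr_sumr.
  by apply: eq_bigr => i _; rewrite -scalerAl linearZ/= mulrA.
(* With an empty family Parseval would give [L (v0 ^+ 2) = 0]. *)
case: n e Se eo es parseval => [|n] e Se eo es parseval.
  by move: v0_gt0; rewrite expr2 (parseval _ Sv0) big_ord0 ltxx.
pose emb (x : 'rV[R]_n.+1) : A := \sum_i x ord0 i *: e i.
have Semb x : S (emb x).
  rewrite /emb; elim/big_ind: _ => // [|u v Su Sv|i _].
  - by have := Slin (-1) _ _ (Se ord0) (Se ord0); rewrite scaleN1r addNr.
  - by rewrite -[u]scale1r; exact: Slin.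
  - have := Slin (x ord0 i - 1) _ _ (Se i) (Se i).
    by rewrite -{2}[e i]scale1r -scalerDl subrK.
have embe x i : L (emb x * e i) = x ord0 i.
  rewrite /emb mulr_suml raddf_sum/= (bigD1 i)//= big1 ?addr0.
    by rewrite -scalerAl linearZ/= eo eqxx mulr1.
  by move=> j ji; rewrite -scalerAl linearZ/= eo (negbTE ji) mulr0.
have sqr_emb x : L (emb x ^+ 2) = \sum_i x ord0 i ^+ 2.
  rewrite expr2 (parseval _ (Semb x)); apply: eq_bigr => i _.
  by rewrite (mulrC (e i)) !embe expr2.
have form_emb x : L (f * emb x ^+ 2) =
    \sum_i \sum_j x ord0 i * x ord0 j * L (f * (e i * e j)).
  rewrite expr2 /emb mulr_suml mulr_sumr raddf_sum/=.
  apply: eq_bigr => i _; rewrite mulr_sumr mulr_sumr raddf_sum/=.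
  apply: eq_bigr => j _.
  by rewrite -scalerAl -!scalerAr !linearZ/= mulrA.
have ccoord i : continuous (fun x : 'rV[R]_n.+1 => x ord0 i).
  exact: coord_continuous.
pose sphere := [set x : 'rV[R]_n.+1 | \sum_i x ord0 i ^+ 2 = 1].
have ne_sphere : sphere !=set0.
  exists (\row_i (i == ord0)%:R); rewrite /sphere/=.
  rewrite (bigD1 ord0)//= mxE eqxx expr1n big1 ?addr0// => i i0.
  by rewrite mxE (negbTE i0) expr0n.
have compact_sphere : compact sphere.
  apply: bounded_closed_compact.
    exists 1; split; first exact: num_real.
    move=> M M1 x /= x1; apply: le_trans (ltW M1).
    rewrite [leLHS]/Num.norm /= mx_normrE; apply: bigmax_le => // -[i j] _ /=.
    rewrite ord1 -(@ler_pXn2r _ 2) ?nnegrE// expr1n real_normK ?num_real//.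
    by rewrite -x1 (bigD1 j)//= lerDl sumr_ge0// => k _; exact: sqr_ge0.
  have -> : sphere = (fun x : 'rV[R]_n.+1 =>
    \sum_i x ord0 i ^+ 2) @^-1` [set 1].
    by [].
  apply: preimage_closed; last exact: closed_eq.
  move=> x _; apply: continuous_sum => i y; apply: continuousM; exact: ccoord.
have [x + xmin] : exists2 x, x \in sphere & forall y, y \in sphere ->
    L (f * emb x ^+ 2) <= L (f * emb y ^+ 2).
  apply: compact_EVT_min => //; apply: continuous_subspaceT => x.
  have -> : (fun x => L (f * emb x ^+ 2)) = (fun x : 'rV[R]_n.+1 =>
    \sum_i \sum_j x ord0 i * x ord0 j * L (f * (e i * e j))).
    by apply/funext => y; exact: form_emb.
  move: x; apply: continuous_sum => i; apply: continuous_sum => j z.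
  apply: (@continuousM _ _ (fun x : 'rV[R]_n.+1 => x ord0 i * x ord0 j)).
    by apply: continuousM; exact: ccoord.
  exact: cst_continuous.
rewrite inE => x1; exists (emb x); split; [exact: Semb|by rewrite sqr_emb|].
move=> v Sv.
(* For [v] of norm 0, [L (f * v ^+ 2)] is 0 as well, so both sides vanish. *)
have [v_eq0|v_neq0] := eqVneq (L (v ^+ 2)) 0.
  by rewrite v_eq0 mulr0 mulrC -mulrA positive_functional_null.
have v_gt0 : 0 < L (v ^+ 2) by rewrite lt0r v_neq0 L_sqr_ge0.
pose q := (Num.sqrt (L (v ^+ 2)))^-1.
have qq : q ^+ 2 * L (v ^+ 2) = 1.
  by rewrite /q exprVn sqr_sqrtr ?ltW// mulVf.
(* The coordinates of [v] after normalization. [emb y] need not equal [q *: v], but [L] gives the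
   same value on their products with any [w]. *)
pose y : 'rV[R]_n.+1 := \row_i (q * L (v * e i)).
have emby w : L (emb y * w) = q * L (v * w).
  rewrite (parseval _ (Semb y)) (parseval _ Sv) mulr_sumr.
  by apply: eq_bigr => i _; rewrite embe mxE mulrA.
have y1 : y \in sphere.
  rewrite inE /sphere/= -sqr_emb expr2 emby (mulrC v) emby mulrA.
  by rewrite -!expr2 qq.
have := xmin _ y1.
have -> : L (f * emb y ^+ 2) = q ^+ 2 * L (f * v ^+ 2).
  rewrite (mulrC f) expr2 -mulrA emby mulrCA emby mulrA -expr2.
  by rewrite mulrA -expr2 (mulrC f).
move=> xy; rewrite -(ler_pM2l (_ : 0 < q ^+ 2)); last first.
  by rewrite exprn_gt0// invr_gt0 sqrtr_gt0.
by rewrite mulrCA qq mulr1.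
Qed.

End positive_functional.

(** * Rotating the ray of integration *)

Lemma continuous_normr_powR {R : realType} (a : R) :
  0 < a -> continuous (fun x : R => `|x| `^ a).
Proof.
move=> a0 x; have [->|x0] := eqVneq x 0.
  apply/cvgrPdist_lt => e e0; rewrite normr0 powR0 ?gt_eqF//.
  have ea : 0 < e `^ a^-1 by rewrite powR_gt0.
  have := @nbhs0_lt _ R _ ea; apply: filterS => y ye.
  rewrite sub0r normrN norm_powR// normr_id.
  have -> : e = (e `^ a^-1) `^ a.
    by rewrite -powRrM mulVf ?gt_eqF// powRr1 ?ltW.
  by apply: gt0_ltr_powR => //; rewrite ?nnegrE ?powR_ge0.
apply: (@continuous_comp _ _ _ (fun x : R => `|x|) (fun y => y `^ a)).
  exact: norm_continuous.
apply/differentiable_continuous/derivable1_diffP/derivable_powR.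
by rewrite in_itv/= andbT normr_gt0.
Qed.

Lemma is_derive_normr_powR {R : realType} (a x : R) : 0 < x ->
  is_derive x 1 (fun y : R => `|y| `^ a) (a * x `^ (a - 1)).
Proof.
move=> x0; apply: (@near_eq_is_derive _ _ _ (fun y => y `^ a)).
- by apply: filterS (lt_nbhsr x0) => y y0; rewrite ger0_norm// ltW.
- exact: is_derive1_powR.
Qed.

Section rotation.
Context {R : realType} (a b : R) (m : nat).
Hypothesis a_gt0 : 0 < a.
Local Notation mu := (@lebesgue_measure R).
Local Notation nu := (m.+1%:R / a).

Definition rot_arg (t x : R) : R := b * sin t * `|x| `^ a - nu * t.

Definition rot_exp (t x : R) : R := expR (- (b * cos t * `|x| `^ a)).

(* The imaginary part of e^(- i nu t) x^m exp(- b |x|^a e^(- i t)). Its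
   derivatives satisfy d_t rot = d_x rot_prim, so its integral over [0, +oo[
   does not depend on t as long as b cos t > 0. *)
Definition rot (t x : R) : R := x ^+ m * rot_exp t x * sin (rot_arg t x).

(** If [Phi] is the complex function described above, this is the imaginary part of
    [- (i / a) x Phi]. Differentiating [x Phi] in [x] brings out the factor
    [m + 1 - a b x^a e^(- i t)], and [- i / a] times that is the factor brought out of [Phi] by
    differentiating in [t]. *)
Definition rot_prim (t x : R) : R :=
  - a^-1 * (x ^+ m.+1 * rot_exp t x * cos (rot_arg t x)).

Definition drot (t x : R) : R :=
  x ^+ m * rot_exp t x *
  (b * sin t * `|x| `^ a * sin (rot_arg t x) +
   (b * cos t * `|x| `^ a - nu) * cos (rot_arg t x)).

Lemma is_derive_rot (t x : R) : is_derive t 1 (rot^~ x) (drot t x).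
Proof.
rewrite /drot /rot /rot_exp /rot_arg.
apply: is_derive_eq.
by rewrite /GRing.scale/=; ring.
Qed.

Lemma is_derive_rot_prim (t x : R) : 0 < x ->
  is_derive x 1 (rot_prim t) (drot t x).
Proof.
move=> x0.
(* Abstracting the power into [p], known only through its value and derivative at [x], reduces the
   claim to an algebraic identity. *)
suff deriv (p : R -> R) : p x = x * x `^ (a - 1) ->
    is_derive x 1 p (a * x `^ (a - 1)) ->
    is_derive x 1 (fun y => - a^-1 *
      (y ^+ m.+1 * expR (- (b * cos t * p y)) * cos (b * sin t * p y - nu * t)))
    (x ^+ m * expR (- (b * cos t * p x)) *
      (b * sin t * p x * sin (b * sin t * p x - nu * t) +
      (b * cos t * p x - nu) * cos (b * sin t * p x - nu * t))).
  apply: (deriv (fun y => `|y| `^ a)); last exact: is_derive_normr_powR.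
  by rewrite ger0_norm ?ltW// mulr_powRB1// ltW.
move=> px dp.
have dX : is_derive x 1 (fun y : R => y ^+ m.+1) (m.+1%:R * x ^+ m).
  have := @is_deriveX R R id m.+1 x 1 1 (is_derive_id _ _).
  by rewrite /GRing.scale/= mulr1 exprfctE.
apply: is_derive_eq.
rewrite /GRing.scale/= px; move: (x `^ (a - 1)) => q.
rewrite -[m.+1%:R]natr1 exprS.
by field; rewrite gt_eqF.
Qed.

End rotation.

Section rotation_integral.
Context {R : realType} (a b : R) (m : nat).
Hypothesis a_gt0 : 0 < a.
Local Notation mu := (@lebesgue_measure R).
Local Notation nu := (m.+1%:R / a).

Let pow_continuous : continuous (fun x : R => `|x| `^ a).
Proof. exact: continuous_normr_powR. Qed.

Let lin_continuous (c d : R) : continuous (fun x : R => c * `|x| `^ a - d).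
Proof.
by move=> x; apply: cvgB; [apply: cvgMl_tmp;
  exact: pow_continuous|exact: cvg_cst].
Qed.

Lemma continuous_rot_exp t : continuous (rot_exp a b t).
Proof.
move=> x; rewrite /rot_exp.
apply: (@continuous_comp _ _ _ (fun x : R => - (b * cos t * `|x| `^ a)) expR).
  by apply: cvgN; apply: cvgMl_tmp; exact: pow_continuous.
exact: continuous_expR.
Qed.

Lemma continuous_rot_arg t : continuous (rot_arg a b m t).
Proof. exact: lin_continuous. Qed.

Lemma continuous_rot t : continuous (rot a b m t).
Proof.
move=> x; apply: cvgM; first apply: cvgM.
- exact: exprn_continuous.
- exact: continuous_rot_exp.
- apply: (@continuous_comp _ _ _ (rot_arg a b m t) sin).
    exact: continuous_rot_arg.
  exact: continuous_sin.
Qed.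

Lemma continuous_drot t : continuous (drot a b m t).
Proof.
move=> x; apply: cvgM; [apply: cvgM|apply: cvgD; apply: cvgM].
- exact: exprn_continuous.
- exact: continuous_rot_exp.
- by apply: cvgMl_tmp; exact: pow_continuous.
- apply: (@continuous_comp _ _ _ (rot_arg a b m t) sin).
    exact: continuous_rot_arg.
  exact: continuous_sin.
- exact: lin_continuous.
- apply: (@continuous_comp _ _ _ (rot_arg a b m t) cos).
    exact: continuous_rot_arg.
  exact: continuous_cos.
Qed.

Lemma continuous_rot_prim t : continuous (rot_prim a b m t).
Proof.
move=> x; apply: cvgMl_tmp; apply: cvgM; first apply: cvgM.
- exact: exprn_continuous.
- exact: continuous_rot_exp.
- apply: (@continuous_comp _ _ _ (rot_arg a b m t) cos).
    exact: continuous_rot_arg.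
  exact: continuous_cos.
Qed.

(** [rot_prim] vanishes at 0 through the factor [x ^+ m.+1]. The fundamental theorem of calculus
    asks for a derivative only inside the interval, so a singular derivative of [|x|^a] at 0 does no
    harm. *)
Lemma integral_drot t N : 0 < N ->
  (\int[mu]_(x in `[0, N]) drot a b m t x)%R = rot_prim a b m t N.
Proof.
move=> N0; rewrite /Rintegral (@continuous_FTC2 _ _ (rot_prim a b m t))//.
- by rewrite /= {2}/rot_prim exprS !mul0r mulr0 subr0.
- exact/continuous_subspaceT/continuous_drot.
- split.
  + move=> x; rewrite in_itv/= => /andP[x0 _].
    by have [] := @is_derive_rot_prim R a b m a_gt0 t x x0.
  + by apply: cvg_at_right_filter; exact: continuous_rot_prim.
  + by apply: cvg_at_left_filter; exact: continuous_rot_prim.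
- move=> x; rewrite in_itv/= => /andP[x0 _]; rewrite derive1E.
  by have /@derive_val := @is_derive_rot_prim R a b m a_gt0 t x x0.
Qed.

Let rot_integrable t N : mu.-integrable `[0, N] (EFin \o rot a b m t).
Proof.
apply: continuous_compact_integrable; first exact: segment_compact.
exact/continuous_subspaceT/continuous_rot.
Qed.

(** A bound independent of [t], which allows differentiation under the integral sign. As [cos t] may
    be negative, the exponential is only bounded by [exp(b N^a)]. *)
Lemma drot_le t N x : 0 <= b -> 0 <= x <= N ->
  `|drot a b m t x| <=
  N ^+ m * expR (b * N `^ a) * (b * N `^ a + (b * N `^ a + nu)).
Proof.
move=> b0 /andP[x0 xN]; have N0 := le_trans x0 xN.
have pN : 0 <= `|x| `^ a <= N `^ a.
  rewrite powR_ge0/= ger0_norm// ge0_ler_powR//; exact: ltW.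
have nu0 : 0 <= nu by rewrite divr_ge0// ltW.
have cosle s : `|b * cos s| <= b.
  by rewrite normrM ger0_norm// ler_piMr// cos_max.
have sinle s : `|b * sin s| <= b.
  by rewrite normrM ger0_norm// ler_piMr// sin_max.
have bp c : `|c| <= b -> `|c * `|x| `^ a| <= b * N `^ a.
  move=> cb; rewrite normrM ler_pM//.
  by case/andP: pN => p0 pN; rewrite ger0_norm.
rewrite /drot normrM ler_pM//.
  rewrite normrM ler_pM//.
    by rewrite normrX ger0_norm// lerXn2r.
  rewrite ger0_norm ?expR_ge0// ler_expR (le_trans _ (bp _ (cosle t)))//.
  by rewrite (le_trans (ler_norm _))// normrN.
rewrite (le_trans (ler_normD _ _))// lerD//.
  by rewrite normrM -[leRHS]mulr1 ler_pM ?bp ?sin_max.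
rewrite normrM -[leRHS]mulr1 ler_pM ?cos_max//.
by rewrite (le_trans (ler_normB _ _))// lerD ?bp// ger0_norm.
Qed.

Lemma is_derive_integral_rot (t N : R) : 0 <= b -> 0 <= N ->
  is_derive t 1 (fun t => \int[mu]_(x in `[0, N]) rot a b m t x)%R
    (\int[mu]_(x in `[0, N]) drot a b m t x)%R.
Proof.
move=> b0 N0.
set C := N ^+ m * expR (b * N `^ a) * (b * N `^ a + (b * N `^ a + nu)).
have C0 : 0 <= C.
  have := @drot_le t N 0 b0; rewrite lexx N0 => /(_ isT).
  by apply: le_trans.
have It : [set` `]t - 1, t + 1[] t by rewrite /= in_itv/=; apply/andP; split;
  lra.
have derf (s x : R) : derivable (rot a b m ^~ x) s 1.
  by have [] := @is_derive_rot R a b m s x.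
have dE s x : partial1of2 (rot a b m) s x = drot a b m s x.
  rewrite partial1of2E.
  by have /@derive_val := @is_derive_rot R a b m s x.
have intC : mu.-integrable `[0, N] (EFin \o cst C).
  apply: continuous_compact_integrable; first exact: segment_compact.
  by apply: continuous_subspaceT => x; exact: cst_continuous.
have ub (s x : R) : [set` `]t - 1, t + 1[] s -> [set` `[0, N]] x ->
    `|partial1of2 (rot a b m) s x| <= cst C x.
  by move=> _; rewrite /= in_itv/= dE => ?; exact: drot_le.
apply: DeriveDef.
  exact: (derivable_under_integral (mu := mu) (measurable_itv _) It
    (fun s _ => rot_integrable s N)
    (fun s x _ _ => derf s x) (fun=> C0) intC ub).
rewrite -derive1E
  (differentiation_under_integral (mu := mu) (measurable_itv _) It
  (fun s _ => rot_integrable s N)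
  (fun s x _ _ => derf s x) (fun=> C0) intC ub).
by apply: eq_Rintegral => x _; rewrite dE.
Qed.

(** At angle 0 the integrand is 0, so by the mean value theorem the integral is [t] times its
    derivative at some [c] in []0, t[], and that derivative is the boundary term [rot_prim] at angle
    [c] and endpoint [N]. *)
Lemma integral_rot_le (t N : R) : 0 < t < pi / 2 -> b * cos t = 1 -> 0 < N ->
  `|\int[mu]_(x in `[0, N]) rot a b m t x|%R <=
  t / a * (N ^+ m.+1 * expR (- N `^ a)).
Proof.
move=> /andP[t0 tpi] bt N0.
have ct : 0 < cos t.
  by apply: cos_gt0_pihalf; rewrite tpi andbT (lt_trans _ t0)//
    oppr_lt0 divr_gt0 ?pi_gt0.
have b0 : 0 <= b.
  by rewrite -(pmulr_lge0 _ ct) bt ler01.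
pose F (s : R) := (\int[mu]_(x in `[0, N]) rot a b m s x)%R.
have dF (s : R) : is_derive s 1 F (\int[mu]_(x in `[0, N]) drot a b m s x)%R.
  exact: is_derive_integral_rot b0 (ltW N0).
have cF : {within `[0, t], continuous F}.
  apply: derivable_within_continuous => s _.
  by have [] := dF s.
have [c + Fc] := MVT t0 (fun s _ => dF s) cF.
rewrite in_itv/= => /andP[c0 c_lt_t].
have F0 : F 0 = 0.
  rewrite /F (_ : rot a b m 0 = cst 0) ?Rintegral_cst ?mul0r//.
  apply/funext => x.
  by rewrite /rot /rot_arg sin0 !mulr0 mul0r subr0 sin0 mulr0.
rewrite -/(F t) -[F t]subr0 -F0 Fc subr0 normrM (ger0_norm (ltW t0)) mulrC.
have t0' := ltW t0; have a0' := ltW a_gt0; have N0' := ltW N0.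
rewrite -mulrA ler_wpM2l//.
rewrite integral_drot// /rot_prim normrM normrN normrV ?unitfE ?gt_eqF//.
rewrite ger0_norm// ler_wpM2l ?invr_ge0//.
rewrite normrM -[leRHS]mulr1 ler_pM ?cos_max// normrM.
rewrite ler_pM// ?normrX ?ger0_norm// /rot_exp ?ler_expR ?expR_ge0//.
rewrite lerN2 ger0_norm// -[leLHS]mul1r ler_wpM2r ?powR_ge0//.
have t_pi : t < pi by rewrite (lt_trans tpi)// gtr_pMr ?pi_gt0//
  invf_lt1 ?ltr1n.
(* The cosine decreases on [[0, pi]], hence [b cos c >= b cos t = 1]. *)
rewrite -bt ler_wpM2l// ltW// ltr_cos// in_itv/=; apply/andP; split; lra.
Qed.

End rotation_integral.

(** * Decay, integrability and symmetry of integrals on the line *)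

Lemma monomial_expR_powR_le {R : realType} (a : R) (k : nat) : 0 < a ->
  exists2 C, 0 <= C & forall x, 0 <= x -> x ^+ k * expR (- x `^ a) <= C.
Proof.
(* With [a (j + 1) >= k], the term [y^(j+1) / (j+1)!] of the exponential series at [y = x^a] is at
   least [x^k / (j+1)!] for [x >= 1]; for [x <= 1] the product is at most 1. *)
move=> a0; pose j := Num.bound (k%:R / a).
have kj : k%:R <= a * j.+1%:R.
  rewrite mulrC -ler_pdivrMr// ltW//.
  rewrite (lt_le_trans (archi_boundP _)) ?ler_nat ?leqnSn//.
  by rewrite divr_ge0// ltW.
exists j.+1`!%:R => // x x0.
have [x1|/ltW x1] := leP x 1.
  rewrite (@le_trans _ _ 1) ?ler1n ?fact_gt0//.
  rewrite -[leRHS]mul1r ler_pM ?exprn_ge0 ?expR_ge0 ?exprn_ile1//.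
  by rewrite -expR0 ler_expR oppr_le0 powR_ge0.
rewrite expRN ler_pdivrMr ?expR_gt0//.
have := @expR_ge1Dxn R (x `^ a) j (powR_ge0 _ _).
rewrite -(ler_pM2l (_ : 0 < j.+1`!%:R)) ?ltr0n ?fact_gt0//.
apply: le_trans; rewrite mulrDr mulr1 mulrCA mulfV ?mulr1 ?pnatr_eq0 -?lt0n
  ?fact_gt0//.
rewrite ler_wpDl//.
rewrite -powR_mulrn ?powR_ge0// -powRrM -powR_mulrn//.
exact: ler_powR.
Qed.

Lemma integrable_oneDsqrV {R : realType} :
  (@lebesgue_measure R).-integrable setT (EFin \o (fun x => (oneDsqr x)^-1)).
Proof.
have cont := @continuous_oneDsqrV R.
apply/integrableP; split.
  by apply/measurable_EFinP; exact: continuous_measurable_fun.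
under eq_integral do rewrite /= ger0_norm ?invr_ge0//.
rewrite ge0_symfun_integralT//.
- rewrite -set_itvcy integral0y_oneDsqr -EFinM ltry//.
- by move=> x; rewrite /= /oneDsqr sqrrN.
Qed.

(** If [C] bounds the absolute value of the function and [D] that of its product with [x^2], then
    [(C + D) / (1 + x^2)] dominates it. *)
Lemma integrable_monomial_expR {R : realType} (a : R) (k : nat) : 0 < a ->
  (@lebesgue_measure R).-integrable setT
    (EFin \o (fun x => x ^+ k * expR (- `|x| `^ a))).
Proof.
move=> a0.
have [C C0 Cle] := monomial_expR_powR_le k a0.
have [D D0 Dle] := monomial_expR_powR_le k.+2 a0.
have cont : continuous (fun x : R => x ^+ k * expR (- `|x| `^ a)).
  move=> x; apply: cvgM; first exact: exprn_continuous.
  apply: (@continuous_comp _ _ _ (fun x : R => - `|x| `^ a) expR).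
    by apply: cvgN; exact: continuous_normr_powR.
  exact: continuous_expR.
have := @integrableZl _ _ _ (@lebesgue_measure R) _ measurableT (C + D) _
  (@integrable_oneDsqrV R).
apply: le_integrable => //.
  by apply/measurable_EFinP; exact: continuous_measurable_fun.
move=> x _ /=; rewrite lee_fin [leRHS]ger0_norm; last first.
  by rewrite mulr_ge0 ?addr_ge0// invr_ge0.
rewrite normrM normrX (ger0_norm (expR_ge0 _)).
rewrite ler_pdivlMr ?oneDsqr_gt0// /oneDsqr mulrDr mulr1.
rewrite lerD ?Cle// -real_normK ?num_real// mulrAC -exprD addn2.
exact: Dle.
Qed.

Lemma lebesgue_measure_oppr {R : realType} (A : set (measurableTypeR R)) :
  measurable A ->
  pushforward (@lebesgue_measure R) -%R A = lebesgue_measure A.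
Proof.
have mopp : measurable_fun [set: measurableTypeR R]
    (-%R : R -> measurableTypeR R).
  exact: oppr_measurable.
pose m := isMeasurableFun.Build _ _ _ _ _ mopp.
pose f : {mfun measurableTypeR R >-> measurableTypeR R} :=
  HB.pack (-%R : measurableTypeR R -> measurableTypeR R) m.
move=> mA; apply/esym.
apply: (@lebesgue_measure_unique R (pushforward (@lebesgue_measure R) f)) => //.
move=> _ [[x y] _ <-] /=.
rewrite /pushforward.
(* By uniqueness of Lebesgue measure it is enough to compare lengths on the generating intervals
   []x, y]], whose preimages are [[- y, - x[]. *)
rewrite (_ : _ @^-1` _ = `[- y, - x[%classic); last first.
  by apply/seteqP; split=> z /=; rewrite !in_itv/= ltrNr lerNl andbC.
rewrite !lebesgue_measure_itv/= !lte_fin ltrN2.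
by case: ifP => //; rewrite -!EFinD opprK addrC.
Qed.

Lemma integral_oppr {R : realType} (D : set (measurableTypeR R))
    (f : R -> \bar R) :
  measurable D -> (@lebesgue_measure R).-integrable setT f ->
  (\int[lebesgue_measure]_(x in D) f x =
   \int[lebesgue_measure]_(x in -%R @^-1` D) f (- x)%R)%E.
Proof.
move=> mD intf; have mf : measurable_fun setT f by exact: measurable_int intf.
have mopp : measurable_fun [set: measurableTypeR R]
    (-%R : R -> measurableTypeR R).
  exact: oppr_measurable.
have pushE (g : R -> \bar R) (E : set (measurableTypeR R)) :
    (\int[lebesgue_measure]_(x in E) g x =
     \int[pushforward (@lebesgue_measure R)
        (-%R : R -> measurableTypeR R)]_(x in E) g x)%E.
  by apply: eq_measure_integral => A mA _; exact/esym/lebesgue_measure_oppr.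
rewrite pushE integral_pushforward//.
apply: (integrableS measurableT) => //.
  by rewrite -[X in measurable X]setTI; exact: mopp.
apply/integrableP; split; first exact: measurableT_comp.
have /integrableP[_] := intf.
rewrite pushE ge0_integral_pushforward//.
exact: measurableT_comp.
Qed.

Lemma integral_odd {R : realType} (f : R -> R) :
  (@lebesgue_measure R).-integrable setT (EFin \o f) ->
  (forall x, f (- x) = - f x) ->
  \int[lebesgue_measure]_x f x = 0.
Proof.
move=> intf odd_f; rewrite /Rintegral.
have := integral_oppr measurableT intf.
rewrite preimage_setT.
under [X in _ = X -> _]eq_integral do rewrite /= odd_f EFinN.
rewrite -/(EFin \o f) integralN /=; last exact: integrable_add_def.
have := integrable_fin_num measurableT intf.
move=> /fineK <- [] ; lra.
Qed.

Lemma integral_even {R : realType} (f : R -> R) :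
  (@lebesgue_measure R).-integrable setT (EFin \o f) ->
  (forall x, f (- x) = f x) ->
  \int[lebesgue_measure]_x f x =
  2 * \int[lebesgue_measure]_(x in `[0, +oo[) f x.
Proof.
move=> intf even_f.
have mf : measurable_fun setT (EFin \o f) by exact: measurable_int intf.
have mf' (E : set (measurableTypeR R)) : measurable_fun E f.
  exact/measurable_EFinP/measurable_funTS.
rewrite (_ : setT = `]-oo, 0[%classic `|` `[0, +oo[%classic); last first.
  by rewrite -setCitvr setvU.
rewrite Rintegral_setU//; last 2 first.
- by apply: (integrableS measurableT) => //; exact: measurableU.
- by rewrite -setCitvr; apply/disj_setPCr.
rewrite mulrDl mul1r; congr +%R.
rewrite -[RHS]Rintegral_itv_obnd_cbnd//; last exact: (integrableS measurableT).
rewrite /Rintegral integral_oppr//=.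
rewrite (_ : _ @^-1` _ = `]0, +oo[%classic); last first.
  by apply/seteqP; split=> z /=; rewrite !in_itv/= oppr_lt0 ?andbT.
by under eq_integral do rewrite even_f.
Qed.

(** Dominated convergence with bound [|f|]: at each point the truncations are eventually constant.
    The endpoint [n.+1] is positive, as [integral_rot_le] requires. *)
Lemma cvg_integral_itv0y {R : realType} (f : R -> R) :
  (@lebesgue_measure R).-integrable setT (EFin \o f) ->
  (\int[lebesgue_measure]_(x in `[0%R, n.+1%:R]) f x) @[n --> \oo] -->
  \int[lebesgue_measure]_(x in `[0%R, +oo[) f x.
Proof.
move=> intf.
have mf : measurable_fun setT (EFin \o f) by exact: measurable_int intf.
apply: fine_cvg; rewrite fineK; last first.
  apply: integrable_fin_num => //.
  exact: (integrableS measurableT).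
pose F n : R -> \bar R := (EFin \o f) \_ `[0%R, n.+1%:R].
rewrite [X in X @ _ --> _](_ : _ = fun n =>
    \int[@lebesgue_measure R]_x F n x)%E; last first.
  by apply/funext => n; rewrite integral_mkcond.
rewrite [X in _ --> X]integral_mkcond.
apply: (@dominated_cvg _ _ _ (@lebesgue_measure R) setT measurableT F _
  (abse \o (EFin \o f))) => //.
- by move=> n; apply/(measurable_restrictT _ _).1 => //;
    exact: measurable_funTS.
- move=> x _; apply: cvg_near_cst.
  have [x0|x0] := leP 0 x; last first.
    apply: nearW => n; rewrite /F !patchE !ifF//;
      by apply/negbTE; rewrite notin_setE/= in_itv/= leNgt x0.
  near=> n; rewrite /F !patchE !ifT//;
    rewrite inE/= in_itv/= x0 ?andbT//=.
  by near: n; exists (Num.bound x) => // n /= bn;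
    rewrite ltW// (lt_le_trans (archi_boundP x0))// ler_nat ltnW.
- exact: integrable_abse.
- move=> n x _; rewrite /F patchE; case: ifPn => // _.
  by rewrite (_ : point = 0%E)// abse0 abse_ge0.
Unshelve. all: by end_near. Qed.

Lemma integrable_monomial_expRM {R : realType} (a : R) (k : nat) (h : R -> R) :
  0 < a -> measurable_fun setT h -> (forall x, `|h x| <= 1) ->
  (@lebesgue_measure R).-integrable setT
    (EFin \o (fun x => x ^+ k * expR (- `|x| `^ a) * h x)).
Proof.
move=> a0 mh h1.
apply: (@integrableMl _ _ _ (@lebesgue_measure R) setT measurableT
  (EFin \o (fun x => x ^+ k * expR (- `|x| `^ a))) h) => //.
  exact: integrable_monomial_expR.
exists 1; split; first exact: num_real.
by move=> M M1 x _ /=; rewrite (le_trans (h1 x))// ltW.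
Qed.

Lemma measurable_cos_powR {R : realType} (a c : R) :
  measurable_fun setT (fun x : R => cos (c * `|x| `^ a)).
Proof.
apply: measurableT_comp; first by apply: continuous_measurable_fun;
  exact: continuous_cos.
apply: measurable_funM => //.
by apply: (measurableT_comp (measurable_powR a)); exact: normr_measurable.
Qed.

(** Odd [m] is settled by symmetry. For even [m] the integrand is, up to sign, [rot] at the angle
    [t = a pi / 2] with [b = 1 / cos t], so its integral over [[0, N]] is bounded by a boundary term
    that tends to 0. The condition [a < 1] keeps [t] below [pi / 2], where [cos t > 0]. *)
Lemma integral_monomial_expR_cos {R : realType} (a : R) (m : nat) : 0 < a < 1 ->
  \int[lebesgue_measure]_x
    (x ^+ m * expR (- `|x| `^ a) * cos (tan (a * (pi / 2)) * `|x| `^ a)) = 0.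
Proof.
move=> /andP[a0 a1]; set t := a * (pi / 2); set g := fun x => _.
have intg : (@lebesgue_measure R).-integrable setT (EFin \o g).
  apply: integrable_monomial_expRM => //; first exact: measurable_cos_powR.
  by move=> x; exact: cos_max.
have [om|em] := boolP (odd m).
  apply: integral_odd => // x.
  by rewrite /g normrN exprNn -signr_odd om expr1 !mulNr mul1r.
rewrite integral_even//; last first.
  by move=> x; rewrite /g normrN exprNn -signr_odd (negbTE em) expr0 mul1r.
have t0 : 0 < t by rewrite mulr_gt0// divr_gt0 ?pi_gt0.
have tpi : t < pi / 2 by rewrite gtr_pMl// divr_gt0 ?pi_gt0.
have ct : 0 < cos t.
  by apply: cos_gt0_pihalf; rewrite tpi andbT (lt_trans _ t0)//
    oppr_lt0 divr_gt0 ?pi_gt0.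
pose b := (cos t)^-1.
have bct : b * cos t = 1 by rewrite /b mulVf// gt_eqF.
(* Here [nu t = (m + 1) pi / 2 = pi / 2 + (m / 2) pi], which turns the sine into a cosine with sign
   [- (-1)^(m/2)]. *)
have rotE x : rot a b m t x = - (-1) ^+ m./2 * g x.
  rewrite /rot /rot_exp /rot_arg bct mul1r.
  have -> : b * sin t = tan t by rewrite /b /tan mulrC.
  rewrite /g [RHS]mulrCA; congr (_ * _).
  set y := tan t * _.
  have -> : m.+1%:R / a * t = pi / 2 + pi *+ m./2.
    rewrite /t -{1}(odd_double_half m) (negbTE em) add0n.
    rewrite -muln2 -natr1 natrM -[pi *+ _]mulr_natr.
    by field; rewrite gt_eqF.
  have := alternatingn (@sinDpi R) m./2 (y - (pi / 2 + pi *+ m./2)).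
  rewrite opprD addrA subrK sinB cos_pihalf sin_pihalf mulr0 mulr1 sub0r =>
    ycos.
  rewrite mulNr -mulrN ycos mulrA -exprMn mulrNN mulr1 expr1n mul1r.
  by congr sin; rewrite addrAC.
(* One power more than the [N^(m+1)] of the boundary term, which is therefore at most a multiple of
   [1 / N]. *)
have [C C0 Cle] := monomial_expR_powR_le m.+2 a0.
suff : \int[lebesgue_measure]_(x in `[0, n.+1%:R]) g x @[n --> \oo] --> 0.
  move=> /(cvg_unique _ (cvg_integral_itv0y intg)) ->; last by [].
  by rewrite mulr0.
apply: norm_cvg0.
apply: (@squeeze_cvgr _ _ _ _ (cst 0) (fun n => t / a * (C * n.+1%:R^-1))).
- near=> n; rewrite /= normr_ge0/=.
  have N0 : (0 : R) < n.+1%:R by rewrite ltr0n.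
  have := @integral_rot_le R a b m a0 t _ _ bct N0.
  rewrite t0 tpi => /(_ isT).
  rewrite (_ : Rintegral _ _ _ = - (-1) ^+ m./2 *
    \int[lebesgue_measure]_(x in `[0, n.+1%:R]) g x); last first.
    rewrite -RintegralZl//; first by apply: eq_Rintegral => x _; exact: rotE.
    exact: (integrableS measurableT).
  rewrite normrM normrN normrX normrN1 expr1n mul1r => /le_trans; apply.
  rewrite ler_wpM2l// ?divr_ge0 ?(ltW t0) ?(ltW a0)//.
  rewrite ler_pdivlMr// mulrAC -exprSr Cle//.
- exact: cvg_cst.
- rewrite [X in _ --> X](_ : 0 = t / a * (C * 0)); last by rewrite !mulr0.
  apply: cvgMl_tmp; apply: cvgMl_tmp.
  exact: cvg_harmonic.
Unshelve. all: by end_near. Qed.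

(** * Product measures and densities *)

Section product_of_functions.
Context d1 d2 (T1 : measurableType d1) (T2 : measurableType d2) (R : realType).
Variables (m1 : {sigma_finite_measure set T1 -> \bar R})
          (m2 : {sigma_finite_measure set T2 -> \bar R}).
Variables (u : T1 -> R) (v : T2 -> R).
Hypotheses (intu : m1.-integrable setT (EFin \o u))
           (intv : m2.-integrable setT (EFin \o v)).

Lemma integrable_prod_mul :
  (m1 \x m2)%E.-integrable setT (fun z => (u z.1 * v z.2)%:E).
Proof.
have mu : measurable_fun setT u.
  exact/measurable_EFinP/(measurable_int _ intu).
have mv : measurable_fun setT v.
  exact/measurable_EFinP/(measurable_int _ intv).
apply/integrable12ltyP.
  apply/measurable_EFinP/measurable_funM.
    exact: (measurableT_comp mu).
  exact: (measurableT_comp mv).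
under eq_integral => x _.
  under eq_integral do rewrite /= normrM EFinM.
  rewrite ge0_integralZl//; last first.
    by apply/measurable_EFinP; exact: measurableT_comp.
  over.
have nv : (\int[m2]_y `|v y|%:E)%E \is a fin_num.
  apply: integrable_fin_num => //.
  exact: integrable_norm.
rewrite -(fineK nv).
rewrite ge0_integralZr//.
- apply: lte_mul_pinfty => //.
  + by apply: integral_ge0.
  + by apply: integrable_fin_num => //; exact: integrable_norm.
  + exact: ltry.
- by apply/measurable_EFinP; exact: measurableT_comp.
- by rewrite lee_fin fine_ge0// integral_ge0.
Qed.

Lemma Rintegral_prod_mul :
  \int[(m1 \x m2)%E]_z (u z.1 * v z.2) = \int[m1]_x u x * \int[m2]_y v y.
Proof.
rewrite /Rintegral -integral12_prod_meas1 ?/fubini_F/=;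
  last exact: integrable_prod_mul.
under eq_integral => x _.
  under eq_integral do rewrite EFinM.
  rewrite integralZl//.
  over.
rewrite -(fineK (integrable_fin_num measurableT intv)).
rewrite integralZr//= -fineM//;
  first by rewrite fineK// (integrable_fin_num _ intv).
- exact: (integrable_fin_num measurableT intu).
- exact: (integrable_fin_num measurableT intv).
Qed.

End product_of_functions.

Section lebesgue_tuple_product.
Context {R : realType}.

(** Fubini's theorem splits off the first coordinate and needs the integrability of the remaining
    product, so both claims go through one induction. *)
Lemma integral_lebesgue_tuple_prod n (g : 'I_n -> R -> R) :
  (forall i, (@lebesgue_measure R).-integrable setT (EFin \o g i)) ->
  (lebesgue_tuple n).-integrable setT
    (fun x => (\prod_(i < n) g i (tnth x i))%:E) /\
  \int[lebesgue_tuple n]_x (\prod_(i < n) g i (tnth x i)) =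
  \prod_(i < n) \int[lebesgue_measure]_x g i x.
Proof.
elim: n g => [|n ih] g intg.
  rewrite big_ord0 /Rintegral/=.
  have -> : (fun x : 0.-tuple R => (\prod_(i < 0) g i (tnth x i))%:E) = cst 1%E.
    by apply/funext => x; rewrite big_ord0.
  split; last by rewrite integral_dirac// diracT mul1e.
  apply/integrableP; split => //.
  rewrite integral_dirac//= diracT mul1e ltry//.
have [ihi ihI] := ih (fun i => g (lift ord0 i)) (fun i => intg _).
have mg i : measurable_fun [set: measurableTypeR R] (g i).
  by have := measurable_int _ (intg i) => h; apply/measurable_EFinP; exact: h.
have mprod : measurable_fun setT
    (fun x : n.+1.-tuple R => \prod_(i < n.+1) g i (tnth x i)).
  apply: measurable_prod => i _.
  by apply: (measurableT_comp (mg i)); exact: measurable_tnth.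
have mT := @measurable_tcons R n.
have prodE (z : R * n.-tuple R) : \prod_(i < n.+1) g i (tnth (tcons z) i) =
    g ord0 z.1 * \prod_(i < n) g (lift ord0 i) (tnth z.2 i).
  rewrite big_ord_recl; congr *%R.
  by apply: eq_bigr => i _; rewrite tnthS.
have intcomp : (@lebesgue_measure R \x lebesgue_tuple n)%E.-integrable setT
    ((fun x : n.+1.-tuple R => (\prod_(i < n.+1) g i (tnth x i))%:E)
      \o @tcons R n).
  rewrite /comp; under eq_fun do rewrite prodE.
  exact: (integrable_prod_mul (intg ord0) ihi).
split.
  apply/integrableP; split; first exact/measurable_EFinP.
  rewrite /= /lebesgue_tcons ge0_integral_pushforward//=; last first.
    by apply/measurable_EFinP; exact: measurableT_comp.
  by have /integrableP[] := intcomp.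
rewrite /Rintegral/= /lebesgue_tcons integral_pushforward//=; last first.
  exact/measurable_EFinP.
under eq_integral do rewrite /= prodE.
rewrite big_ord_recl -ihI.
exact: (Rintegral_prod_mul (intg ord0) ihi).
Qed.

End lebesgue_tuple_product.

Section density.
Import HBNNSimple.

(** The equality passes from sets to indicators, to simple functions by linearity, and to [f] by
    monotone convergence along increasing simple functions. *)
Lemma ge0_integral_density d (T : measurableType d) (R : realType)
    (mu nu : {measure set T -> \bar R}) (k : T -> R) (f : T -> \bar R) :
  measurable_fun setT k -> (forall x, 0 <= k x) ->
  (forall A, measurable A -> nu A = \int[mu]_(x in A) (k x)%:E)%E ->
  measurable_fun setT f -> (forall x, 0 <= f x)%E ->
  (\int[nu]_x f x = \int[mu]_x (f x * (k x)%:E))%E.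
Proof.
move=> mk k0 nuE mf f0.
have indicE (r : R) A : 0 <= r -> measurable A ->
    (\int[nu]_x (r * \1_A x)%:E = \int[mu]_x ((r * \1_A x)%:E * (k x)%:E))%E.
  move=> r0 mA; under eq_integral do rewrite EFinM.
  under [RHS]eq_integral do rewrite EFinM -muleA.
  have m1 : measurable_fun setT (fun x => (\1_A x)%:E : \bar R).
    exact/measurable_EFinP.
  rewrite !ge0_integralZl//; last 2 first.
  - by apply: emeasurable_funM => //; exact/measurable_EFinP.
  - by move=> x _; rewrite mule_ge0// lee_fin.
  rewrite integral_indic// setIT nuE// integral_mkcond; congr (_ * _)%E.
  apply: eq_integral => x _; rewrite patchE indicE.
  by case: ifP => xA; rewrite ?xA ?mul1e ?mul0e.
have nnsfE (h : {nnsfun T >-> R}) :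
    (\int[nu]_x (h x)%:E = \int[mu]_x ((h x)%:E * (k x)%:E))%E.
  have hE x : (h x)%:E =
      (\sum_(y \in range h) (y * \1_(h @^-1` [set y]) x)%:E)%E.
    by rewrite fsumEFin// -fimfunE.
  have hkE x : ((h x)%:E * (k x)%:E =
      \sum_(y \in range h) (y * \1_(h @^-1` [set y]) x)%:E * (k x)%:E)%E.
    by rewrite hE ge0_mule_fsuml// => y; exact: nnfun_muleindic_ge0.
  under eq_integral do rewrite hE.
  under [RHS]eq_integral do rewrite hkE.
  have mi y : measurable_fun setT (fun x => (y * \1_(h @^-1` [set y]) x)%:E).
    by apply/measurable_EFinP/measurable_funM.
  rewrite !ge0_integral_fsum//.
  - apply: eq_fsbigr => y; rewrite inE => -[t _ <-].
    by rewrite indicE.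
  - by move=> y; apply: emeasurable_funM => //; exact/measurable_EFinP.
  - by move=> y x _; apply: mule_ge0;
      [exact: nnfun_muleindic_ge0|rewrite lee_fin].
  - by move=> y x _; exact: nnfun_muleindic_ge0.
pose h := nnsfun_approx measurableT mf.
have hf x : (h n x)%:E @[n --> \oo] --> f x.
  by apply: cvg_nnsfun_approx.
have ndh x : {homo (fun n => h n x) : m n / (m <= n)%N >-> m <= n}.
  by move=> m n mn; exact/lefP/nd_nnsfun_approx.
transitivity (limn (fun n => \int[nu]_x (h n x)%:E))%E.
  rewrite -monotone_convergence//.
  - by apply: eq_integral => x _; exact/esym/cvg_lim.
  - by move=> n; exact/measurable_EFinP.
  - by move=> n x _; rewrite lee_fin.
  - by move=> x _ m n mn; rewrite lee_fin ndh.
under eq_fun do rewrite nnsfE.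
rewrite -monotone_convergence//.
- apply: eq_integral => x _; apply/cvg_lim => //.
  by apply: cvgeZr => //; exact: hf.
- by move=> n; apply: emeasurable_funM; exact/measurable_EFinP.
- by move=> n x _; rewrite mule_ge0 ?lee_fin.
- by move=> x _ m n mn; rewrite lee_wpmul2r ?lee_fin// ndh.
Qed.

End density.

(** * The measure Gamma *)

Section Gamma_moments.
Context {R : realType} (a : R) (n : nat).
Hypothesis a0 : 0 < a.
Local Notation lam := (lebesgue_tuple n.+1).
Local Notation w := (@Gamma_weight R a n.+1).


Lemma measurable_peval (p : mpoly n.+1 R) : measurable_fun setT (peval p).
Proof.
rewrite (_ : peval p = fun x =>
  \sum_(m <- msupp p) mcoeff m p * \prod_i tnth x i ^+ m i).
  apply: measurable_sum => m; apply: measurable_funM => //.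
  apply: measurable_prod => i _; apply: measurable_funX.
  exact: measurable_tnth.
by apply/funext => x; rewrite /peval mevalE.
Qed.

(** The test [i == ord0] puts [h] on coordinate 0 alone and gives the integrand the product form
    that [integral_lebesgue_tuple_prod] handles. *)
Lemma Gamma_weight_prod (m : multinom n.+1) (h : R -> R) x :
  \prod_i tnth x i ^+ m i * w x * h (tnth x ord0) =
  \prod_i (tnth x i ^+ m i * expR (- `|tnth x i| `^ a) *
           (if i == ord0 then h (tnth x i) else 1)).
Proof.
rewrite 2!big_split/=; congr (_ * _ * _).
  by rewrite /Gamma_weight -sumrN expR_sum.
by rewrite big_ord_recl/= big1 ?mulr1.
Qed.

(** Expanding [p] in monomials leads to products of one-variable integrals. Taking [h = 1] yields
    integrability of polynomials against the weight; taking [h] to be the cosine yields integral 0,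
    since the factor of coordinate 0 vanishes for every monomial. *)
Lemma integrable_peval_Gamma_weight (p : mpoly n.+1 R) (h : R -> R) :
  measurable_fun setT h -> (forall y, `|h y| <= 1) ->
  (lam).-integrable setT (fun x => (peval p x * w x * h (tnth x ord0))%:E) /\
  ((forall k,
      \int[lebesgue_measure]_y (y ^+ k * expR (- `|y| `^ a) * h y) = 0) ->
   \int[lam]_x (peval p x * w x * h (tnth x ord0)) = 0).
Proof.
move=> mh h1.
pose F (m : multinom n.+1) (x : n.+1.-tuple R) :=
  \prod_i tnth x i ^+ m i * w x * h (tnth x ord0).
have intg (m : multinom n.+1) i :
  (@lebesgue_measure R).-integrable setT (EFin \o
    (fun y => y ^+ m i * expR (- `|y| `^ a) * (if i == ord0 then h y else 1))).
  apply: (@integrable_monomial_expRM R a (m i)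
    (fun y => if i == ord0 then h y else 1) a0); case: (i == ord0) => // y.
  by rewrite normr1.
have FE m : F m = fun x =>
  \prod_i (tnth x i ^+ m i * expR (- `|tnth x i| `^ a) *
    (if i == ord0 then h (tnth x i) else 1)).
  by apply/funext => x; exact: (Gamma_weight_prod m h x).
have intF m : (lam).-integrable setT (fun x => (F m x)%:E).
  by rewrite FE; have [] := integral_lebesgue_tuple_prod (intg m).
have pE x : peval p x * w x * h (tnth x ord0) =
    \sum_(m <- msupp p) mcoeff m p * F m x.
  rewrite /peval mevalE !mulr_suml; apply: eq_bigr => m _.
  by rewrite /F !mulrA.
split.
  under eq_fun do rewrite pE -sumEFin.
  apply: integrable_sum => // m _.
  under eq_fun do rewrite EFinM.
  exact: integrableZl.
move=> h0; rewrite /Rintegral.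
under eq_integral do rewrite pE -sumEFin.
rewrite integral_sum//; last first.
  move=> m; under eq_fun do rewrite EFinM.
  exact: integrableZl.
rewrite big1// => m _.
under eq_integral do rewrite EFinM.
rewrite integralZl// -(fineK (integrable_fin_num measurableT (intF m))).
suff -> : fine (\int[lam]_x (F m x)%:E) = 0 by rewrite mule0.
rewrite FE; have [_] := integral_lebesgue_tuple_prod (intg m).
rewrite big_ord_recl/= h0 mul0r; exact.
Qed.

End Gamma_moments.

Lemma Rintegral_expR_powR_gt0 {R : realType} (a : R) : 0 < a ->
  0 < \int[lebesgue_measure]_x expR (- `|x| `^ a).
Proof.
move=> a0; pose g (x : R) := expR (- `|x| `^ a).
have intg : (@lebesgue_measure R).-integrable setT (EFin \o g).
  have := integrable_monomial_expR 0 a0.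
  by under eq_fun do rewrite expr0 mul1r.
have mg : measurable_fun setT (EFin \o g) by exact: measurable_int intg.
rewrite /Rintegral -lte_fin fineK; last exact: (integrable_fin_num _ intg).
apply: (@lt_le_trans _ _
  (\int[@lebesgue_measure R]_(x in `[0%R, 1%R]) (expR (-1))%:E)%E).
  by rewrite integral_cst//= lebesgue_measure_itv/= lte_fin ltr01 sube0 mule1
    lte_fin expR_gt0.
apply: (@le_trans _ _
  (\int[@lebesgue_measure R]_(x in `[0%R, 1%R]) (g x)%:E)%E).
  apply: ge0_le_integral => //.
  - exact: measurable_funTS.
  - move=> x /=; rewrite in_itv/= => /andP[x0 x1].
    have : x `^ a <= 1 `^ a by apply: ge0_ler_powR; rewrite ?nnegrE// ltW.
    by rewrite powR1 lee_fin ler_expR lerN2 ger0_norm.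
apply: ge0_subset_integral => //.
by move=> x _; rewrite lee_fin expR_ge0.
Qed.

(** * The moment functional of [Gamma] on polynomials *)

Section Gamma_functional.
Context {R : realType} (a : R) (n : nat).
Hypothesis a01 : 0 < a < 1.
Local Notation lam := (lebesgue_tuple n.+1).
Local Notation w := (@Gamma_weight R a n.+1).
Local Notation G := (@Gamma R a n.+1).

Let a0 : 0 < a. Proof. by case/andP: a01. Qed.

Let W : R := \int[lam]_x w x.

(** The integral factors over the coordinates. Since [0^-1 = 0], positivity is what keeps [Gamma]
    from being the zero measure. *)
Lemma Gamma_weight_integral_gt0 : 0 < W.
Proof.
pose g (i : 'I_n.+1) (y : R) := expR (- `|y| `^ a).
have intg i : (@lebesgue_measure R).-integrable setT (EFin \o g i).
  have := integrable_monomial_expR 0 a0.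
  by under eq_fun do rewrite expr0 mul1r.
have [_] := integral_lebesgue_tuple_prod intg.
rewrite /W /Gamma_weight.
under eq_Rintegral do rewrite -expR_sum sumrN.
move=> ->; apply: prodr_gt0 => i _; exact: Rintegral_expR_powR_gt0.
Qed.

Lemma integrable_peval_weight (p : mpoly n.+1 R) :
  (lam).-integrable setT (fun x => (peval p x * w x)%:E).
Proof.
have [y|+ _] := @integrable_peval_Gamma_weight R a n a0 p (cst 1)
  (measurable_cst _).
  by rewrite normr1.
by under eq_fun do rewrite mulr1.
Qed.

Lemma ge0_integral_Gamma (g : n.+1.-tuple R -> \bar R) :
  measurable_fun setT g -> (forall x, 0 <= g x)%E ->
  (\int[G]_x g x = (W^-1)%:E * \int[lam]_x (g x * (w x)%:E))%E.
Proof.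
move=> mg g0.
rewrite (@ge0_integral_density _ _ _ lam G (@Gamma_pdf R a n.+1))//.
- rewrite -ge0_integralZl//.
  + by apply: eq_integral => x _; rewrite /Gamma_pdf EFinM muleCA.
  + apply: emeasurable_funM => //; apply/measurable_EFinP.
    exact: measurable_Gamma_weight.
  + by move=> x _; rewrite mule_ge0// lee_fin expR_ge0.
  + by rewrite lee_fin invr_ge0 ltW// Gamma_weight_integral_gt0.
- exact: measurable_Gamma_pdf.
- exact: Gamma_pdf_ge0.
Qed.

Lemma integrable_peval_Gamma (p : mpoly n.+1 R) :
  G.-integrable setT (EFin \o peval p).
Proof.
have mp := measurable_peval p.
apply/integrableP; split; first exact/measurable_EFinP.
rewrite ge0_integral_Gamma//; last first.
  by apply/measurable_EFinP; exact: measurableT_comp.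
apply: lte_mul_pinfty => //.
  by rewrite lee_fin invr_ge0 ltW// Gamma_weight_integral_gt0.
have /integrableP[_] := integrable_peval_weight p.
apply: le_lt_trans; rewrite le_eqVlt; apply/orP; left; apply/eqP.
apply: eq_integral => x _ /=.
by rewrite normrM (ger0_norm (expR_ge0 _)).
Qed.

Lemma ge0_Rintegral_peval_Gamma (p : mpoly n.+1 R) :
  (forall x, 0 <= peval p x) ->
  \int[G]_x peval p x = W^-1 * \int[lam]_x (peval p x * w x).
Proof.
move=> p0; have mp := measurable_peval p.
rewrite /Rintegral ge0_integral_Gamma//; last exact/measurable_EFinP.
rewrite fineM//.
exact: (integrable_fin_num _ (integrable_peval_weight p)).
Qed.

Definition Gamma_int (p : mpoly n.+1 R) : R := \int[G]_x peval p x.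

Lemma Gamma_int1 : Gamma_int 1 = 1.
Proof.
rewrite /Gamma_int ge0_Rintegral_peval_Gamma; last first.
  by move=> x; rewrite /peval meval1.
under eq_Rintegral do rewrite /peval meval1 mul1r.
by rewrite mulVf// gt_eqF// Gamma_weight_integral_gt0.
Qed.

Lemma Gamma_int_is_scalar : scalar Gamma_int.
Proof.
move=> c p q; rewrite /Gamma_int.
have ip := integrable_peval_Gamma p; have iq := integrable_peval_Gamma q.
under eq_Rintegral do rewrite /peval mevalD mevalZ.
rewrite RintegralD//; last exact: (integrableZl _ _ ip).
by rewrite RintegralZl.
Qed.

Lemma Gamma_int_sqr_ge0 p : 0 <= Gamma_int (p ^+ 2).
Proof.
by apply: Rintegral_ge0 => x _; rewrite /peval expr2 mevalM -expr2 sqr_ge0.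
Qed.

(** The pointwise bound [cle] is integrated against [p^2] times the weight, and the cosine term
    contributes 0. The constant [l] is the same for polynomials of all degrees, which is what
    separates the limit from the minimum. *)
Lemma Gamma_int_coord_ge : exists2 l : R, 0 < l & forall p : mpoly n.+1 R,
  l * Gamma_int (p ^+ 2) <= Gamma_int (mpolyX R (mnm1 ord0) ^+ 2 * p ^+ 2).
Proof.
pose c (y : R) := cos (tan (a * (pi / 2)) * `|y| `^ a).
have mc : measurable_fun setT c by exact: measurable_cos_powR.
have c1 y : `|c y| <= 1 by exact: cos_max.
have cc : continuous c.
  move=> y; apply: (@continuous_comp _ _ _
    (fun y : R => tan (a * (pi / 2)) * `|y| `^ a) cos).
    by apply: cvgMl_tmp; exact: continuous_normr_powR.
  exact: continuous_cos.
have [d /= d0 cd] : exists2 d : R, 0 < d & forall y, `|y| < d -> 2^-1 < c y.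
  have : \forall y \near (0 : R), 2^-1 < c y.
    have c0 : c 0 = 1 by rewrite /c normr0 powR0 ?gt_eqF// mulr0 cos0.
    have /cvgr_gt := cc 0; rewrite c0; apply.
    by rewrite invf_lt1 ?ltr1n.
  move=> /nbhs_ballP[d /= d0 cd]; exists d => // y yd.
  by apply: cd; rewrite /ball/= sub0r normrN.
exists (d ^+ 2 / 3); first by rewrite divr_gt0// exprn_gt0.
move=> p.
(* For [|y| < d] the factor [2 c y] exceeds 1. Otherwise [c y >= -1] and [y^2 >= d^2], so the right
   side is at least [d^2 - 2 d^2 / 3 = d^2 / 3], which explains the divisor 3. *)
have cle y : d ^+ 2 / 3 <= d ^+ 2 / 3 * (2 * c y) + y ^+ 2.
  have [yd|dy] := ltP `|y| d.
    have := cd _ yd; have := sqr_ge0 y; have := sqr_ge0 d; nra.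
  have : d ^+ 2 <= y ^+ 2.
    by rewrite -(real_normK (num_real y)) lerXn2r ?nnegrE// ltW.
  have : -1 <= c y by have := c1 y; rewrite ler_norml => /andP[].
  have := sqr_ge0 d; nra.
rewrite /Gamma_int !ge0_Rintegral_peval_Gamma; last 2 first.
- by move=> x; rewrite /peval !expr2 !mevalM -!expr2 mulr_ge0 ?sqr_ge0.
- by move=> x; rewrite /peval expr2 mevalM -expr2 sqr_ge0.
rewrite mulrCA ler_wpM2l//;
  first by rewrite invr_ge0 ltW// Gamma_weight_integral_gt0.
have intp := integrable_peval_weight (p ^+ 2).
have intfp := integrable_peval_weight (mpolyX R (mnm1 ord0) ^+ 2 * p ^+ 2).
pose h (x : n.+1.-tuple R) := peval (p ^+ 2) x * w x * c (tnth x ord0).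
have [intc intc0'] := integrable_peval_Gamma_weight a0 (p ^+ 2) mc c1.
have intc0 : \int[lam]_x h x = 0.
  by apply: intc0' => k; exact: integral_monomial_expR_cos.
rewrite -RintegralZl//.
(* The 0 added on the right is a multiple of the vanishing integral of [h]; the integrands can then
   be compared pointwise. *)
rewrite -[leRHS]add0r -(mulr0 (d ^+ 2 / 3 * 2)) -intc0 -RintegralZl//.
rewrite -RintegralD//; last exact: (integrableZl _ _ intc).
apply: le_Rintegral => //.
- exact: (integrableZl _ _ intp).
- exact: (integrableD measurableT
    (integrableZl measurableT (d ^+ 2 / 3 * 2) intc) intfp).
move=> x _.
have -> : peval (mpolyX R (mnm1 ord0) ^+ 2 * p ^+ 2) x =
    tnth x ord0 ^+ 2 * peval (p ^+ 2) x.
  by rewrite /peval mevalM expr2 mevalM mevalXU -expr2.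
rewrite /h.
have pw : 0 <= peval (p ^+ 2) x * w x.
  by rewrite mulr_ge0 ?expR_ge0// /peval expr2 mevalM -expr2 sqr_ge0.
rewrite [leRHS](_ : _ =
  (d ^+ 2 / 3 * (2 * c (tnth x ord0)) + tnth x ord0 ^+ 2) *
  (peval (p ^+ 2) x * w x)); last by ring.
by rewrite ler_wpM2r.
Qed.

End Gamma_functional.

(** * The bounds [ub] as Rayleigh minima, and their limit *)

Section upper_bounds.
Context {R : realType} (a : R) (n : nat).
Hypothesis a01 : 0 < a < 1.
Local Notation G := (@Gamma R a n.+1).
Local Notation f := (mpolyX R (mnm1 ord0) ^+ 2 : mpoly n.+1 R).
Local Notation Gint := (@Gamma_int R a n).

Let L : {scalar mpoly n.+1 R} :=
  HB.pack Gint (GRing.isLinear.Build _ _ _ _ Gint (Gamma_int_is_scalar a01)).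

Definition mdegree_le r (p : mpoly n.+1 R) := (mmeasure mdeg p <= r.+1)%N.

Lemma min_rayleigh_mdegree_le r : exists m : mpoly n.+1 R,
  [/\ mdegree_le r m, Gint (m ^+ 2) = 1 &
    forall v, mdegree_le r v ->
      Gint (f * m ^+ 2) * Gint (v ^+ 2) <= Gint (f * v ^+ 2)].
Proof.
(* The spanning family consists of the monomials of degree less than [r.+1]; the constant 1 is the
   vector of positive norm. *)
apply: (@min_rayleigh_quotient R (mpoly n.+1 R) L
  (@Gamma_int_sqr_ge0 R a n) f (mdegree_le r) (bmultinom n.+1 r.+1)
  (fun m => mpolyX R (bmnm m)) 1).
- move=> c u v; rewrite /mdegree_le => ur vr.
  rewrite (leq_trans (mmeasureD_le _ _ _))// geq_max vr andbT.
  by rewrite (leq_trans (msizeZ_le _ _)).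
- by move=> m; rewrite /mdegree_le msizeX; exact: bmdeg.
- by move=> v vr; exists (fun m => mcoeff (bmnm m) v); exact: mpolywE.
- by rewrite /mdegree_le msize1.
- by rewrite expr1n (_ : L 1 = 1) ?ltr01//; exact: Gamma_int1.
Qed.

Lemma Gamma_int_sum (ps : seq (mpoly n.+1 R)) (g : mpoly n.+1 R) :
  Gint (g * \sum_(p <- ps) p ^+ 2) = \sum_(p <- ps) Gint (g * p ^+ 2).
Proof. by rewrite mulr_sumr; exact: (raddf_sum L). Qed.

(** Summing the Rayleigh inequality over the squares of a normalized sum shows that the single
    square [m ^+ 2] is optimal. Attainment matters: the default value 0 of [minimum] would coincide
    with the minimum of [f]. *)
Lemma ub_is_minimum r (m : mpoly n.+1 R) :
  mdegree_le r m -> Gint (m ^+ 2) = 1 ->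
  (forall v, mdegree_le r v ->
    Gint (f * m ^+ 2) * Gint (v ^+ 2) <= Gint (f * v ^+ 2)) ->
  ub f G r = Gint (f * m ^+ 2).
Proof.
move=> mr m1 mmin; apply: minimumE.
have fgE s : \int[G]_x (peval f x * peval s x) = Gint (f * s).
  by apply: eq_Rintegral => x _; rewrite /peval [RHS]mevalM.
split.
  exists (m ^+ 2); last exact: fgE. split; last exact: m1.
  by exists [:: m]; [rewrite /= andbT; exact: mr|rewrite big_seq1].
move=> _ [s [[ps psr ->] s1] <-].
rewrite fgE Gamma_int_sum.
have {}s1 : \sum_(p <- ps) Gint (p ^+ 2) = 1.
  rewrite -[RHS]s1 -[RHS]/(Gint _) -[in RHS](mul1r (\sum_(_ <- _) _))
    Gamma_int_sum.
  by apply: eq_bigr => p _; rewrite mul1r.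
rewrite -[leLHS]mulr1 -s1 mulr_sumr; rewrite [leLHS]big_seq [leRHS]big_seq.
apply: ler_sum => p pps.
by apply: mmin; exact: (allP psr).
Qed.

(** An optimal polynomial for [r] is still admissible for [r.+1]. *)
Lemma ub_nonincreasing : nonincreasing_seq (ub f G).
Proof.
apply/nonincreasing_seqP => r.
have [m [mr m1 mmin]] := min_rayleigh_mdegree_le r.
have [m' [mr' m1' mmin']] := min_rayleigh_mdegree_le r.+1.
rewrite (ub_is_minimum mr m1 mmin) (ub_is_minimum mr' m1' mmin').
rewrite -[leLHS]mulr1 -m1; apply: mmin'.
exact: leq_trans mr _.
Qed.

Lemma minimum_range_sqr : is_minimum (range (peval f)) 0.
Proof.
have fE x : peval f x = tnth x ord0 ^+ 2 by rewrite /peval expr2 mevalM mevalXU.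
split; last by move=> _ [x _ <-]; rewrite fE sqr_ge0.
exists [tuple 0 | i < n.+1] => //.
by rewrite fE tnth_mktuple expr0n.
Qed.

(** The lower bound [l > 0] is uniform in [r], so the monotone sequence converges to a limit that is
    at least [l], whereas the minimum of [f] is 0. *)
Lemma ub_coord_sqr : [/\ has_minimum (range (peval f)), cvgn (ub f G) &
  minimum (range (peval f)) < limn (ub f G)].
Proof.
rewrite (minimumE minimum_range_sqr).
have [l l0 lle] := @Gamma_int_coord_ge R a n a01.
have ubl r : l <= ub f G r.
  have [m [mr m1 mmin]] := min_rayleigh_mdegree_le r.
  by rewrite (ub_is_minimum mr m1 mmin) -[l]mulr1 -m1; exact: lle.
have cvg_ub : cvgn (ub f G).
  apply: nonincreasing_is_cvgn; first exact: ub_nonincreasing.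
  by exists l => _ [r _ <-].
split=> //; first by exists 0; exact: minimum_range_sqr.
rewrite (lt_le_trans l0)//; apply: limr_ge => //.
by apply: nearW => r; exact: ubl.
Qed.

End upper_bounds.

Theorem theorem6 (R : realType) (alpha : R) (alpha01 : 0 < alpha < 1) :
  (forall n : nat, (1 <= n)%N ->
    exists f : mpoly n R,
      [/\ has_minimum (range (peval f)),
          cvgn (ub f (Gamma alpha n)) &
          minimum (range (peval f)) < limn (ub f (Gamma alpha n))]) /\
  (let f : mpoly 1 R := mpolyX R (mnm1 ord0) ^+ 2 in
    [/\ has_minimum (range (peval f)),
        cvgn (ub f (Gamma alpha 1)) &
        minimum (range (peval f)) < limn (ub f (Gamma alpha 1))]).
Proof.
split; last exact: ub_coord_sqr.
by case=> // n _; exists (mpolyX R (mnm1 ord0) ^+ 2); exact: ub_coord_sqr.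
Qed.
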